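(* Let $X$ and $Y$ be metric spaces and let $f:X\to Y$ be a map. Then $f$ is not $O\cup LC_1$-measurable if and only if there exists a point $x\in X$ such that $f$ is not $O\cup LC_1$-measurable at $x$.
   Context: A subset of $X$ is an $LC_1$ set if it is the intersection of an open and a closed subset of $X$; it is an $O\cup LC_1$ set if it is the union of an open set and an $LC_1$ set. The map $f$ (not assumed continuous) is not $O\cup LC_1$-measurable if there is an open set $U\subseteq Y$ such that $f^{-1}(U)$ is not an $O\cup LC_1$ set in $X$. Let $D_0=\{0\}\subset\mathbb{R}$ and, for $k\ge 1$, let $D_k=\{2^{-n_1}+\dots+2^{-n_k} : n_1<n_2<\dots<n_k,\ n_i\in\mathbb{N}^+\}$. Let $S_3=D_0\cup D_1\cup D_2\cup D_3$, a compact subspace of $\mathbb{R}$. For $x\in X$, a set $S_3(x)\subseteq X$ is the image of $S_3$ under some homeomorphism $h$ of $S_3$ onto a subspace of $X$ with $h(0)=x$; write $D_j(x)=h(D_j)$, so $S_3(x)=D_0(x)\cup D_1(x)\cup D_2(x)\cup D_3(x)$. The map $f$ is not $O\cup LC_1$-measurable at $x$ if there exist an open neighbourhood $U\subseteq Y$ of $f(x)$ and such a set $S_3(x)$ with $f^{-1}(U)\cap S_3(x)=D_0(x)\cup D_2(x)$. *)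

(* Defs.v *)
From HB Require Import structures.
From mathcomp Require Import all_boot all_order all_algebra.
From mathcomp Require Import all_classical all_reals topology.

Set Implicit Arguments.
Unset Strict Implicit.
Unset Printing Implicit Defensive.

Import Order.TTheory GRing.Theory Num.Theory.
Import numFieldTopology.Exports.

Local Open Scope classical_set_scope.
Local Open Scope ring_scope.

Definition LC1 (X : topologicalType) (A : set X) : Prop :=
  exists V C : set X, [/\ open V, closed C & A = V `&` C].

Definition OLC1 (X : topologicalType) (A : set X) : Prop :=
  exists O L : set X, [/\ open O, LC1 L & A = O `|` L].

Definition not_OLC1_measurable (X Y : topologicalType) (f : X -> Y) : Prop :=
  exists U : set Y, open U /\ ~ OLC1 (f @^-1` U).

(* The sequence s lists the exponents n_1 < ... < n_k.  For k = 0 it is empty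
   and so is the sum; see D0E. *)
Definition D (R : realType) (k : nat) : set R :=
  [set t | exists s : seq nat,
    [/\ size s = k, sorted ltn s, all (fun n => 0 < n)%N s
      & t = \sum_(n <- s) 2 ^- n]].
Arguments D R k : clear implicits.

Lemma D0E (R : realType) : D R 0 = [set 0].
Proof.
apply/seteqP; split=> [t [s [/size0nil-> _ _ ->]] | t ->] /=.
  by rewrite big_nil.
by exists [::]; rewrite big_nil.
Qed.

Definition S3 (R : realType) : set R := D R 0 `|` D R 1 `|` D R 2 `|` D R 3.
Arguments S3 R : clear implicits.

(* h restricts to a homeomorphism of A onto the subspace h @` A of X; only the
   values of h on A and of its inverse g on h @` A matter. *)
Definition homeo_onto_image (T X : topologicalType) (A : set T) (h : T -> X) :
    Prop :=
  {within A, continuous h} /\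
  exists g : X -> T,
    {within h @` A, continuous g} /\ (forall t, A t -> g (h t) = t).

Definition not_OLC1_measurable_at (R : realType) (X Y : metricType R)
    (f : X -> Y) (x : X) : Prop :=
  exists (U : set Y) (h : R -> X),
    [/\ open_nbhs (f x) U, homeo_onto_image (S3 R) h, h 0 = x
      & f @^-1` U `&` h @` S3 R = h @` D R 0 `|` h @` D R 2].

(* Main.v *)
Require Import Defs.
From mathcomp Require Import all_boot all_order all_algebra.
From mathcomp Require Import all_classical all_reals topology.
From mathcomp Require Import lra.

(** Let A be the preimage of an open set.  Start from the complement of A,
    and repeatedly take the points of the closure of the previous set that lie
    on the other side of A.  This gives the residues of A, and [OLC1P] shows
    that A is the union of an open set and a locally closed set exactly when
    the third residue is empty.  A point x of the third residue lies in A, is a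
    limit of points outside A, each of which is a limit of points of A, each of
    which is a limit of points outside A: this is the pattern of S3(x).

    To turn such iterated limits into a copy of S3, and to read them off a given
    copy, S3 is coded by the increasing sequences of at most three positive
    exponents.  These form a tree in which the children n1 ... nk n of a node
    tend to that node as n grows.  A family of points indexed by the tree is a
    topological embedding as soon as the descendants through the n-th child of
    a node lie, around that node, in an annulus of radii comparable to c(n),
    where c at least halves at each step ([annular_embedding]).  The sums of
    powers of 1/2 have this property ([binsum_annular]), and the points
    approximating a point of the third residue can be chosen to have it
    ([residue_annular]).  Matching the two families gives the homeomorphism
    ([copy_of_residue]).  Conversely, continuity of h on S3 shows by induction
    that h maps D_i into the residue of index 3 - i, so h 0 lies in the third
    residue ([residue_of_copy]). *)

Set Implicit Arguments.
Unset Strict Implicit.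
Unset Printing Implicit Defensive.

Import Order.TTheory GRing.Theory Num.Theory.
Import numFieldTopology.Exports.

Local Open Scope classical_set_scope.
Local Open Scope ring_scope.

(** * Residues and the class of unions of an open and a locally closed set *)

(** Each residue lies in the closure of the preceding one, and consecutive
    residues are on opposite sides of A, the odd ones inside A. *)
Fixpoint residue (X : topologicalType) (A : set X) (k : nat) : set X :=
  (if odd k then A else ~` A) `&`
  (if k is k'.+1 then closure (residue A k') else setT).

(** Let A be the union of an open O and of V `&` C.  The first and the third
    residue do not meet O, since their points have points outside A in each
    neighbourhood, whereas O is open and contained in A.  Hence a
    point of residue 3 lies in V; near it there is, in V, a point of residue 2,
    which is therefore outside the closed C; near that one there is a point of
    residue 1 outside C, which must then be in O: a contradiction.
    Conversely, the points of A that are not interior form residue 1; when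
    residue 3 is empty this set is the difference of its closure and the
    closure of residue 2, hence locally closed. *)
Lemma OLC1P (X : topologicalType) (A : set X) :
  OLC1 A <-> residue A 3 = set0.
Proof.
split=> [[O [_ [Oop [V [C [Vop Ccl ->]]] AE]]]|res0].
  rewrite -subset0 => x [Ax clx].
  have notO k y : residue A k.+1 y -> ~ odd k -> ~ O y.
    move=> [_ cly] Nk Oy.
    have [z [rz Oz]] := cly _ (open_nbhs_nbhs (conj Oop Oy)).
    have : (if odd k then A else ~` A) z by case: (k) rz => [|?] [].
    by move/negP/negbTE : Nk => -> ; apply; rewrite AE; left.
  have Vx : V x.
    by move: (Ax); rewrite AE => -[/(@notO 2 x (conj Ax clx) notF)|[]].
  have [y [[/= nAy cly] Vy]] := clx _ (open_nbhs_nbhs (conj Vop Vx)).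
  have nCy : (~` C) y by move=> Cy; apply: nAy; rewrite AE; right.
  have [z [rz nCz]] := cly _ (open_nbhs_nbhs (conj (closed_openC Ccl) nCy)).
  have := rz.1; rewrite /= {1}AE => -[/(@notO 0 z rz notF)|[_ /nCz]] //.
exists (interior A), (~` closure (residue A 2) `&` closure (residue A 1)).
split; first exact: open_interior.
  exists (~` closure (residue A 2)), (closure (residue A 1)); split=> //.
    exact/closed_openC/closed_closure.
  exact: closed_closure.
apply/seteqP; split=> [x Ax|x [/interior_subset //|[n2 c1]]].
  have [iAx|niAx] := pselect ((interior A) x); [by left|right; split].
    by move=> c2; have : set0 x by rewrite -res0.
  apply: subset_closure; split => //=; rewrite setIT.
  by rewrite closure_setC.
by apply: contrapT => nAx; apply: n2; apply: subset_closure.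
Qed.

(** * The tree of exponents and its topology *)

Definition tree (j k : nat) : pred (seq nat) :=
  fun s => path ltn j s && (size s <= k)%N.

(** The nodes u with [extends_from N s u] are s itself and the descendants of s
    whose first exponent after s is at least N; for varying N they form a base
    of neighbourhoods of s. *)
Fixpoint extends_from (N : nat) (s u : seq nat) : bool :=
  match s, u with
  | [::], [::] => true
  | [::], b :: _ => (N <= b)%N
  | _ :: _, [::] => false
  | a :: s', b :: u' => (a == b) && extends_from N s' u'
  end.

Lemma extends_from_cat N s u : extends_from N s (s ++ u) = extends_from N [::] u.
Proof. by elim: s => //= a s ->; rewrite eqxx. Qed.

(** The first new exponent of a proper descendant u of s cannot exceed the sum
    of all exponents of u, so the tree topology is separated. *)
Lemma extends_from_eq s u : extends_from (sumn u).+1 s u -> s = u.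
Proof.
have weaken : forall s u M N, (M <= N)%N -> extends_from N s u -> extends_from M s u.
  elim=> [|a s' IH] [|b u'] //= M N MN; first exact: leq_trans.
  by case/andP=> -> /(IH _ _ _ MN) ->.
elim: s u => [|a s IH] [|b u] //=; first by rewrite ltnNge leq_addr.
case/andP=> /eqP -> nsu; rewrite (IH u) //; apply: weaken nsu.
by rewrite ltnS leq_addl.
Qed.

(** Both halves together say that p is a homeomorphism of T, with the topology
    given by [extends_from], onto its image: the first is continuity of p, the
    second continuity of its inverse. *)
Definition tree_embedding (R : realType) (M : metricType R)
    (T : pred (seq nat)) (p : seq nat -> M) : Prop :=
  forall s, T s ->
  (forall e, 0 < e -> exists N, forall u, T u -> extends_from N s u ->
     mdist (p s) (p u) < e) /\
  (forall N, exists2 d, 0 < d & forall u, T u -> mdist (p s) (p u) < d ->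
     extends_from N s u).

Lemma tree_embedding_inj (R : realType) (M : metricType R)
    (T : pred (seq nat)) (p : seq nat -> M) s u :
  tree_embedding T p -> T s -> T u -> p s = p u -> s = u.
Proof.
move=> pT Ts Tu psu; apply: extends_from_eq.
have [_ /(_ (sumn u).+1) [d d0]] := pT s Ts; apply=> //.
by rewrite psu mdistxx.
Qed.

(** Applied to (p, q) and to (q, p), this gives both halves of a homeomorphism
    between the two images. *)
Lemma tree_embedding_continuous (R : realType) (M M' : metricType R)
    (T : pred (seq nat)) (p : seq nat -> M) (q : seq nat -> M') (h : M -> M') :
  tree_embedding T p -> tree_embedding T q ->
  (forall s, T s -> h (p s) = q s) ->
  {within p @` [set` T], continuous h}.
Proof.
move=> pT qT hpq; apply/subspace_continuousP => _ [s Ts <-] B.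
rewrite /from_subspace hpq // => /nbhs_ballP[e /= e0 eB].
have [/(_ e e0) [N NP] _] := qT s Ts.
have [_ /(_ N) [d d0 dP]] := pT s Ts.
apply/nbhs_ballP; exists d => //= y + [u Tu uy].
rewrite -{y}uy ballEmdist /= => /(dP u Tu) /(NP u Tu) sue.
by apply: eB; rewrite hpq // ballEmdist.
Qed.

(** * Families with children in nested annuli *)

(** The ratio 7/4 of the radii is below 2, so that distinct annuli around a node
    are a positive distance apart; it is also as small as the sums of powers of
    1/2 permit, since 1 + 1/2 + 1/4 is 7/4. *)
Fixpoint annular (R : realType) (M : metricType R) (j k : nat)
    (p : seq nat -> M) : Prop :=
  if k is k'.+1 then
    exists c : nat -> R, [/\ forall n, 0 < c n, forall n, c n.+1 <= c n / 2,
      forall n u, tree j k (n :: u) ->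
        c n <= mdist (p [::]) (p (n :: u)) <= 7 / 4 * c n
      & forall n, (j < n)%N -> annular n k' (fun u => p (n :: u))]
  else True.

Lemma halving_le (R : realType) (c : nat -> R) m n :
  (forall n, 0 < c n) -> (forall n, c n.+1 <= c n / 2) -> (m < n)%N ->
  c n <= c m / 2.
Proof.
move=> c0 c2 /subnK <-; elim: (n - m.+1)%N => [|i IH]; first exact: c2.
by apply: le_trans IH; have := c2 (i + m.+1)%N; have := c0 (i + m.+1)%N; lra.
Qed.

Lemma halving_lt (R : realType) (c : nat -> R) e :
  (forall n, 0 < c n) -> (forall n, c n.+1 <= c n / 2) -> 0 < e ->
  exists N, forall n, (N <= n)%N -> c n < e.
Proof.
move=> c0 c2 e0.
have cn n : c n * n.+1%:R <= c 0.
  elim: n => [|n IH]; first by rewrite mulr1.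
  apply: le_trans IH; have := c2 n; have := c0 n; have := c0 n.+1 => h1 h2 h3.
  rewrite -[n.+2%:R]natr1 mulrDr mulr1.
  have : (1:R) <= n.+1%:R by rewrite ler1n.
  nra.
exists (Num.truncn (c 0 / e)) => n Nn.
have : c 0 / e < n.+1%:R.
  by apply: lt_le_trans (truncnS_gt _) _; rewrite ler_nat ltnS.
rewrite ltr_pdivrMr // => h; have := cn n.
have : (0:R) < n.+1%:R by rewrite ltr0n.
by move=> n0 h'; rewrite -(ltr_pM2r n0) [e * _]mulrC; apply: le_lt_trans h' h.
Qed.

(** For continuity of the inverse, the nodes s and u are followed from the root
    to their first difference.  If they leave a common ancestor through children
    a and b, the annuli of a and b around it are at distance at least c a / 8,
    since the outer radius of the inner annulus is at most 7/8 of the inner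
    radius of the outer one.  If one of them stops at that ancestor, the
    distance is at least the inner radius for the child taken by the other. *)
Lemma annular_embedding (R : realType) (M : metricType R) (j k : nat)
    (p : seq nat -> M) :
  annular j k p -> tree_embedding (tree j k) p.
Proof.
elim: k j p => [|k IH] j p.
  move=> _ [|a s]; last by rewrite /tree andbF.
  move=> _; split=> [e e0|N].
    by exists 0%N => -[|b u]; rewrite /tree ?andbF //= mdistxx.
  by exists 1 => // -[|b u]; rewrite /tree ?andbF.
move=> [c [c0 c2 cP cA]] [|a s'].
  move=> _; split=> [e e0|N].
    have e1 : 0 < e / 2 by lra.
    have [N NP] := halving_lt c0 c2 e1.
    exists N => -[|b u]; first by rewrite mdistxx.
    move=> Tu /= /NP h; have /andP[_ h'] := cP _ _ Tu.
    by apply: le_lt_trans h' _; lra.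
  exists (c N) => // -[//|b u] Tu /=; rewrite leqNgt => h.
  apply/negP => bN; have := halving_le c0 c2 bN.
  have /andP[+ _] := cP _ _ Tu; have := c0 b.
  by move: h; lra.
have Tcons b u : tree j k.+1 (b :: u) -> (j < b)%N /\ tree b k u.
  by rewrite /tree /= ltnS => /andP[/andP[-> ->] ->].
move=> Ts; have [ja Ts'] := Tcons _ _ Ts.
have [IH1 IH2] := IH a _ (cA a ja) s' Ts'.
split=> [e e0|N].
  have [N NP] := IH1 e e0; exists N => -[|b u] Tu //= /andP[/eqP ab su].
  by subst b; apply: NP => //; have [] := Tcons _ _ Tu.
have [d d0 dP] := IH2 N.
have ca := c0 a.
exists (Num.min d (c a / 8)); first by rewrite lt_min d0; lra.
have /andP[s1 s2] := cP _ _ Ts.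
move=> [|b u] Tu /=; rewrite lt_min => /andP[dl cl].
  by move: s1; rewrite metric_sym; lra.
have [ab|ba|ab] := ltngtP a b; last first.
- by subst b; rewrite /= dP //; have [] := Tcons _ _ Tu.
- have := halving_le c0 c2 ba; have /andP[u1 u2] := cP _ _ Tu.
  by have := metric_triangle (p [::]) (p (a :: s')) (p (b :: u)); lra.
- have := halving_le c0 c2 ab; have /andP[u1 u2] := cP _ _ Tu.
  have := metric_triangle (p [::]) (p (b :: u)) (p (a :: s')).
  by rewrite (metric_sym (p (b :: u))); lra.
Qed.

(** * The compact set S3 as an annular family *)

Definition binsum (R : realType) (s : seq nat) : R := \sum_(n <- s) 2 ^- n.

(** The upper bound is the geometric sum of [size s] consecutive powers, and
    leaves the gap below [2 ^- n] that separates siblings. *)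
Lemma binsum_bounds (R : realType) n s : path ltn n s ->
  0 <= binsum R s <= 2 ^- n * (1 - 2 ^- size s).
Proof.
have pos m : (0 : R) < 2 ^- m by rewrite invr_gt0 exprn_gt0.
have half m : (2 ^- m.+1 : R) = 2 ^- m / 2 by rewrite exprSr invfM.
elim: s n => [|m s IH] n /=.
  by rewrite /binsum big_nil expr0 invr1 subrr mulr0 lexx.
case/andP=> nm /IH /andP[s0 s1].
have c0 : forall n, (0 : R) < 2 ^- n by [].
have c2 : forall n, (2 ^- n.+1 : R) <= 2 ^- n / 2 by move=> i; rewrite half.
have := halving_le c0 c2 nm; rewrite /binsum big_cons -!/(binsum R s) half.
have := pos (size s); have := pos m; have := pos n; move: s0 s1.
have : (2 ^- size s : R) <= 1 by rewrite invf_le1 ?exprn_gt0 // exprn_ege1 // ler1n.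
move: (2 ^- m : R) (2 ^- n : R) (2 ^- size s : R) (binsum R s) => a b z t.
by move=> z1 t0 t1 b0 a0 z0 ab; apply/andP; split; nra.
Qed.

(** The offset x is there for the induction: the subtree of the child n is the
    same family translated by [2 ^- n].  The type R^o carries the distance of
    the line. *)
Lemma binsum_annular (R : realType) (x : R) j k : (k <= 3)%N ->
  @annular R R^o j k (fun s => x + binsum R s).
Proof.
elim: k x j => [//|k IH] x j k3.
have pos m : (0 : R) < 2 ^- m by rewrite invr_gt0 exprn_gt0.
exists (fun n => 2 ^- n); split=> //.
- by move=> n; rewrite exprSr invfM.
- move=> n u /andP[/= /andP[_ nu] uk].
  have /andP[u0 u1] := binsum_bounds R nu.
  have u2 : (2 ^- 2 : R) <= 2 ^- size u.
    rewrite lef_pV2 ?posrE ?exprn_gt0 // ler_weXn2l ?ler1n //.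
    by rewrite -ltnS; apply: leq_ltn_trans k3.
  rewrite /mdist /= /binsum big_nil big_cons -/(binsum R u).
  have pn := pos n; rewrite ger0_norm; last by lra.
  move: u0 u1 u2 pn; rewrite expr2.
  move: (2 ^- n : R) (2 ^- size u : R) (binsum R u) => a z t u0 u1 u2 a0.
  by apply/andP; split; nra.
- move=> n _; under eq_fun => u do rewrite /binsum big_cons addrA.
  by apply: IH; apply: ltnW.
Qed.

(** * From a point of a residue to a copy of S3 and back *)

(** Points z n of the preceding residue are picked ever closer to y, each at
    most half as far as the one before.  The subtree of the n-th child is built
    inductively in the ball about z n of radius a quarter of the distance d n
    of z n from y, so it stays between 3/4 and 5/4 of d n from y. *)
Lemma residue_annular (R : realType) (X : metricType R) (A : set X) k y r :
  0 < r -> residue A k y ->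
  exists p : seq nat -> X, [/\ p [::] = y, forall j, annular j k p
    & forall s, (size s <= k)%N ->
        mdist y (p s) < r /\ residue A (k - size s) (p s)].
Proof.
elim: k y r => [|k IH] y r r0 Ay.
  exists (fun=> y); split=> // -[|//] _; by rewrite mdistxx.
(* A point close to y in the preceding residue differs from y, since it is
   on the other side of A. *)
have next e : exists z, 0 < e -> [/\ residue A k z, 0 < mdist y z & mdist y z < e].
  have [e0|] := pselect (0 < e); last by exists y.
  have [z [rz]] := Ay.2 _ (nbhsx_ballx y e e0); rewrite ballEmdist /= => ze.
  exists z => _; split=> //; rewrite mdist_gt0; apply/eqP => yz; subst z.
  have : (if odd k then A else ~` A) y by case: (k) rz => [|?] [].
  by case: Ay => /= + _; case: (odd k).
have [nx nxP] := choice next.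
pose z := fix z n := nx (if n is n'.+1 then mdist y (z n') / 2 else r / 2).
have r2 : 0 < r / 2 by lra.
have z0 n : 0 < mdist y (z n).
  elim: n => [|n IHn] /=; first by have [] := nxP _ r2.
  by have [] // := nxP (mdist y (z n) / 2); lra.
have zS n : mdist y (z n.+1) <= mdist y (z n) / 2.
  have e0 : 0 < mdist y (z n) / 2 by have := z0 n; lra.
  by have [_ _ /ltW] := nxP _ e0.
have zr n : mdist y (z n) < r / 2.
  elim: n => [|n IHn]; first by have [] := nxP _ r2.
  by have := zS n; have := z0 n; lra.
have rz n : residue A k (z n).
  case: n => [|n]; first by have [] := nxP _ r2.
  have e0 : 0 < mdist y (z n) / 2 by have := z0 n; lra.
  by have [] := nxP _ e0.
have /choice [q qP] n : exists q : seq nat -> X, [/\ q [::] = z n,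
    forall j, annular j k q & forall s, (size s <= k)%N ->
      mdist (z n) (q s) < mdist y (z n) / 4 /\ residue A (k - size s) (q s)].
  by apply: IH => //; have := z0 n; lra.
have dq n u : (size u <= k)%N ->
    3 / 4 * mdist y (z n) <= mdist y (q n u) <= 5 / 4 * mdist y (z n).
  have [_ _ /(_ u) + uk] := qP n; case=> // qu _.
  have := metric_triangle y (z n) (q n u).
  have := metric_triangle y (q n u) (z n).
  rewrite (metric_sym (q n u)) => h1 h2.
  by apply/andP; split; lra.
exists (fun s => if s is n :: u then q n u else y); split=> //.
- move=> j; exists (fun n => 3 / 4 * mdist y (z n)); split.
  + by move=> n; have := z0 n; lra.
  + by move=> n; have := zS n; lra.
  + move=> n u /andP[_ uk]; have /andP[h1 h2] := dq n u uk.
    by have zn := z0 n; apply/andP; split; lra.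
  + by move=> n _; have [_ + _] := qP n.
- move=> [_|n u uk]; first by rewrite mdistxx subn0.
  have [_ _ /(_ u uk) [_ ?]] := qP n; split=> //.
  by have /andP[_] := dq n u uk; have := zr n; lra.
Qed.

Lemma D_binsum (R : realType) k : (k <= 3)%N ->
  D R k = binsum R @` [set s | tree 0 3 s /\ size s = k].
Proof.
move=> k3; have sortedE s : sorted ltn s && all (fun n => 0 < n)%N s = path ltn 0 s.
  by rewrite (path_sortedE ltn_trans) andbC.
apply/seteqP; split=> [t [s [sk ss s0 ->]]|t [s [/andP[ps _] sk] <-]] /=.
  by exists s => //; rewrite /tree -sortedE ss s0 sk k3.
by move: ps; rewrite -sortedE => /andP[ss s0]; exists s.
Qed.

Lemma S3_binsum (R : realType) : S3 R = binsum R @` [set` tree 0 3].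
Proof.
rewrite /S3 !D_binsum //; apply/seteqP; split=> [t|t [s Ts <-]].
  by move=> [[[]|]|] [s [Ts _] <-]; exists s.
have : (size s <= 3)%N by case/andP: Ts.
case E: (size s) => [|[|[|[|//]]]] _; [do 3 left|do 2 left; right|left; right|right];
  by exists s.
Qed.

Lemma binsum_embedding (R : realType) :
  @tree_embedding R R^o (tree 0 3) (binsum R).
Proof.
apply: annular_embedding.
by have := @binsum_annular R 0 0 3 isT; under eq_fun => u do rewrite add0r.
Qed.

(** Injectivity of h decides on which side of A each point of the copy lies.
    Each node of the tree is the limit of its children, so continuity of h puts
    its image in the closure of theirs, and the residue index grows by one at
    each step from the leaves to the root. *)
Lemma residue_of_copy (R : realType) (X : metricType R) (A : set X)
    (h : R -> X) :
  homeo_onto_image (S3 R) h ->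
  A `&` h @` S3 R = h @` D R 0 `|` h @` D R 2 ->
  residue A 3 (h 0).
Proof.
move=> [hc [g [_ gK]]] AE.
have bT := binsum_embedding R.
have S3b s : tree 0 3 s -> S3 R (binsum R s) by move=> Ts; rewrite S3_binsum; exists s.
have inj s u : tree 0 3 s -> tree 0 3 u -> h (binsum R s) = h (binsum R u) -> s = u.
  move=> Ts Tu hsu; apply: (tree_embedding_inj bT) => //.
  by rewrite -[LHS]gK ?hsu ?gK //; apply: S3b.
have side s : tree 0 3 s -> (if odd (3 - size s) then A else ~` A) (h (binsum R s)).
  move=> Ts; have s3 : (size s <= 3)%N by case/andP: Ts.
  have hs : (h @` S3 R) (h (binsum R s)) by exists (binsum R s) => //; apply: S3b.
  rewrite oddB //=; case: ifPn => os.
    suff : (A `&` h @` S3 R) (h (binsum R s)) by case.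
    rewrite AE !D_binsum //.
    by case E: (size s) s3 os => [|[|[|[|]]]] // _ _; [left|right];
      exists (binsum R s) => //; exists s.
  move=> As; have : (A `&` h @` S3 R) (h (binsum R s)) by [].
  rewrite AE !D_binsum // => -[] [_ [u [Tu us] <-]] /inj us'.
    by move: os; rewrite -us' // us.
  by move: os; rewrite -us' // us.
have main k s : tree 0 3 s -> size s = (3 - k)%N -> (k <= 3)%N ->
    residue A k (h (binsum R s)).
  elim: k s => [|k IH] s Ts sk k3.
    by split=> //; have := side s Ts; rewrite sk.
  split; first by have := side s Ts; rewrite sk subKn.
  move=> B; move/subspace_continuousP : hc => /(_ _ (S3b _ Ts)) /[apply].
  move=> /nbhs_ballP[e /= e0 eB].
  have [/(_ e e0) [N NP] _] := bT s Ts.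
  (* The new exponent is at least N for closeness, and exceeds the last one of
     s to keep the sequence increasing. *)
  pose u := s ++ [:: maxn N (last 0%N s).+1].
  have Tu : tree 0 3 u.
    case/andP: Ts => ps _; rewrite /tree cat_path ps /= leq_maxr /=.
    by rewrite size_cat sk /= addn1 ltn_subrL.
  exists (h (binsum R u)); split.
    apply: IH => //; last exact: ltnW.
    by rewrite size_cat sk /= addn1 subnSK.
  apply: (eB (binsum R u)) (S3b _ Tu).
  have := NP u Tu; rewrite extends_from_cat /= leq_maxl => /(_ isT).
  by rewrite /ball /= distrC.
have -> : 0 = binsum R [::] by rewrite /binsum big_nil.
exact: main.
Qed.

(** Points with the same code in the two annular families correspond; h and its
    inverse g are obtained by decoding, which is well defined because
    embeddings are injective. *)
Lemma copy_of_residue (R : realType) (X : metricType R) (A : set X) x :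
  residue A 3 x ->
  exists h : R -> X, [/\ homeo_onto_image (S3 R) h, h 0 = x
    & A `&` h @` S3 R = h @` D R 0 `|` h @` D R 2].
Proof.
move=> rx; have [p [p0 pA pR]] := residue_annular (ltr01 : 0 < 1 :> R) rx.
have bT := binsum_embedding R.
have pT := annular_embedding (pA 0%N).
pose h t := p (xget [::] [set s | tree 0 3 s /\ binsum R s = t]).
pose g y := binsum R (xget [::] [set s | tree 0 3 s /\ p s = y]).
have hb s : tree 0 3 s -> h (binsum R s) = p s.
  move=> Ts; rewrite /h; case: xgetP => [u _ [Tu us]|/(_ s) []//].
  by rewrite (tree_embedding_inj bT Tu Ts us).
have gp s : tree 0 3 s -> g (p s) = binsum R s.
  move=> Ts; rewrite /g; case: xgetP => [u _ [Tu us]|/(_ s) []//].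
  by rewrite (tree_embedding_inj pT Tu Ts us).
have hS3 : h @` S3 R = p @` [set` tree 0 3].
  rewrite S3_binsum; apply/seteqP; split=> [_ [_ [s Ts <-] <-]|_ [s Ts <-]].
    by rewrite hb //; exists s.
  by exists (binsum R s); [exists s|rewrite hb].
have hD k : (k <= 3)%N -> h @` D R k = p @` [set s | tree 0 3 s /\ size s = k].
  move=> k3; rewrite D_binsum //.
  apply/seteqP; split=> [_ [_ [s [Ts sk] <-] <-]|_ [s [Ts sk] <-]].
    by rewrite hb //; exists s.
  by exists (binsum R s); [exists s|rewrite hb].
exists h; split.
- split; first by rewrite S3_binsum; exact: (tree_embedding_continuous bT pT hb).
  exists g; split; first by rewrite hS3; exact: (tree_embedding_continuous pT bT gp).
  by rewrite S3_binsum => _ [s Ts <-]; rewrite hb // gp.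
- by rewrite -p0 -(hb [::]) // /binsum big_nil.
- rewrite hS3 !hD //.
  have side s : tree 0 3 s -> (if odd (3 - size s) then A else ~` A) (p s).
    move=> /andP[_ s3]; have [_] := pR s s3.
    by case: (3 - size s)%N => [|?] [].
  apply/seteqP; split=> [y [As [s Ts sy]]|_ [] [s [Ts sk] <-]].
  + subst y; have := side s Ts; have : (size s <= 3)%N by case/andP: Ts.
    by case E: (size s) => [|[|[|[|]]]] //= _ _; [left|right]; exists s.
  + by split; [have := side s Ts; rewrite sk|exists s].
  + by split; [have := side s Ts; rewrite sk|exists s].
Qed.

(** * Characterisation of non-measurable maps *)

Theorem mainTheorem6 (R : realType) (X Y : metricType R) (f : X -> Y) :
  not_OLC1_measurable f <-> exists x : X, not_OLC1_measurable_at f x.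
Proof.
split=> [[U [Uop /OLC1P/eqP/set0P[x rx]]]|[x [U [h [[Uop _] hh hx AE]]]]].
  have [h [hh h0 AE]] := copy_of_residue rx.
  by exists x, U, h; split=> //; split=> //; case: rx.
exists U; split=> // /OLC1P r0.
by have : residue (f @^-1` U) 3 (h 0) := residue_of_copy hh AE; rewrite r0.
Qed.
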